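(* Let $X\subseteq\mathbb R$, let $\phi\in C^1(X)$ be real-valued, and let $\mathrm{fl}:\mathbb R\to\mathbb R$ be a floating-point rounding map for which there exist a finite set $\mathbb F\subset\mathbb R$ and a unit roundoff $u>0$ such that, for all $r\in\mathbb F$, $$\forall y\in I_r=\{y\,:\,|y-r|<u|r|\}:\qquad \mathrm{fl}(y)=r .$$ Assume that there exists an open and connected interval $J$ such that $$J\subseteq\phi(X)\cap\bigcup_{r\in\mathbb F}\overline{I_r}.$$ Furthermore, assume that $m=\inf_{y\in J}|y|>0$, that $|J|\ge4uM$ with $M=\sup_{y\in J}|y|$, and that $L=\sup_{x\in\phi^{-1}(J)}|\phi'(x)|<\infty$. Then there exists a constant $C>0$ (independent of $u$) such that $$\|\mathrm{fl}(\phi)-\phi\|_{L^2(X)}^2\ \ge\ \|\mathrm{fl}(\phi)-\phi\|_{L^2(\phi^{-1}(J))}^2\ \ge\ Cu^2 .$$ In particular, one may take $$C=\frac{|J|}{6L}\,\frac{m^3}{M}\,\min_{y\in J}\mathrm{card}(\phi^{-1}(y)).$$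
   Context: $X$ is measurable; $L^2(X)$ and $L^2(\phi^{-1}(J))$ are taken with respect to Lebesgue measure. $\phi^{-1}(\cdot)$ denotes the pre-image in $X$, $\mathrm{card}(\phi^{-1}(y))$ is the cardinality of the set $\{x\in X:\phi(x)=y\}$, $|J|$ is the length of $J$, and $\overline{I_r}$ is the closure of $I_r$. $\mathrm{fl}(\phi)=\mathrm{fl}\circ\phi$, with $\mathrm{fl}$ measurable. The set $\mathbb F$ is the set of representable numbers of a round-to-nearest system; the cells $I_r$, $r\in\mathbb F$, on which $\mathrm{fl}$ takes the different values $r$ are therefore pairwise disjoint. Nothing is assumed about $\mathrm{fl}$ at the borders of the cells or outside their union. *)

(* Defs.v *)
From mathcomp Require Import all_boot all_order all_algebra.
From mathcomp Require Import all_classical all_reals all_analysis.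

Set Implicit Arguments.
Unset Strict Implicit.
Unset Printing Implicit Defensive.

Import Order.TTheory GRing.Theory Num.Theory.
Import numFieldNormedType.Exports.

Local Open Scope classical_set_scope.
Local Open Scope ring_scope.

(* The real line with the Lebesgue (not only Borel) measurable sets; this is
   the domain of completed_lebesgue_measure. *)
Notation lebesgueTypeR R :=
  (caratheodory_type (measure_extension.mu_ext (@wlength R idfun))).

Section Definitions.
Context {R : realType}.
Implicit Types (X J D F : set R) (phi dphi fl f : R -> R) (u r y : R).

Definition lebesgue_measurable_set X : Prop :=
  measurable (X : set (lebesgueTypeR R)).

(* Lebesgue sets on the domain side, Borel sets on the codomain side. *)
Definition lebesgue_measurable_fun f : Prop :=
  measurable_fun [set: lebesgueTypeR R]
    (f : lebesgueTypeR R -> measurableTypeR R).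

Definition L2norm D f : \bar R :=
  Lnorm (@completed_lebesgue_measure R) 2%:E ((EFin \o f) \_ D).

(* phi is C^1 on X with derivative dphi: difference quotients are taken along
   points of X only, so values of phi outside X are irrelevant and derivatives
   at the end points of an interval are one-sided.  At isolated points of X,
   where a derivative is not determined, any value of dphi is allowed. *)
Definition is_C1_on X phi dphi : Prop :=
  (forall x, X x ->
     (phi y - phi x) / (y - x) @[y --> within X x^'] --> dphi x) /\
  {within X, continuous dphi}.

Definition cell u r : set R := [set y | `|y - r| < u * `|r|].

(* Disjointness of the cells is not required separately: a common point y of
   two cells would give r = fl y = s. *)
Definition is_rounding fl F u : Prop :=
  [/\ lebesgue_measurable_fun fl, finite_set F, 0 < u &
      forall r, F r -> forall y, cell u r y -> fl y = r].

Definition preimage_in X phi J : set R := X `&` phi @^-1` J.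

(* The real-valued inf and sup below are used for nonempty J contained in a
   finite union of bounded cells; for empty J, min_abs J is 0. *)
Definition interval_length J : R := sup J - inf J.

Definition min_abs J : R := inf [set `|y| | y in J].

Definition max_abs J : R := sup [set `|y| | y in J].

Definition slopes X phi dphi J : set R :=
  [set `|dphi x| | x in preimage_in X phi J].

(* Counting measure of the fibre: +oo for an infinite fibre.  The infimum is
   attained because the values are extended natural numbers. *)
Definition min_card X phi J : \bar R :=
  ereal_inf [set counting (preimage_in X phi [set y]) | y in J].

(* It is +oo exactly when all fibres over J are infinite (and the real factor
   is positive); the norms are then infinite as well. *)
Definition explicit_constant X phi dphi J : \bar R :=
  ((interval_length J / (6 * sup (slopes X phi dphi J)) *
    (min_abs J ^+ 3 / max_abs J))%:E * min_card X phi J)%E.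

Definition roundoff_bound X phi J fl u (C : \bar R) : Prop :=
  let err := fun x => fl (phi x) - phi x in
  (L2norm (preimage_in X phi J) err ^+ 2 <= L2norm X err ^+ 2)%E /\
  (C * (u ^+ 2)%:E <= L2norm (preimage_in X phi J) err ^+ 2)%E.

End Definitions.

(* Main.v *)
Require Import Defs.
From mathcomp Require Import all_boot all_order all_algebra finmap.
From mathcomp Require Import all_classical all_reals all_analysis.
From mathcomp Require Import measurable_realfun ring lra.
Import Order.TTheory GRing.Theory Num.Theory.
Import numFieldNormedType.Exports.
Local Open Scope classical_set_scope.
Local Open Scope ring_scope.

(** The squared error is first estimated in the variable [y = phi x], where it
    does not involve [phi], and then pulled back along [phi].

    In the variable [y], the error on the cell of [r] is [`|y - r|]. A cell
    that meets J has length [2 * u * `|r|], which is less than [4 * u * M] and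
    so less than the length of J: J is not contained in the cell, and the piece
    of the cell inside J is an interval sharing at least one end point with the
    cell. On such a piece the mean of [(y - r)^2] is at least
    [(u * `|r|)^2 / 4] ([integral_sqr_cell_ge]); a piece around the centre alone
    would not satisfy such a bound. Since J does not contain 0, its length is at
    most [M - m], whence [m <= M * (1 - 4 * u)]; together with
    [m <= (1 + u) * `|r|] this gives
    [u^2 * m^3 / (6 * M) <= (u * `|r|)^2 / 4] ([relative_bound]). The closed
    cells cover J, and the end points of the finitely many cells form a null
    set, so summing over the cells bounds the integral over J of
    [(fl y - y)^2] below by [u^2 * m^3 / (6 * M)] times the length of J
    ([integral_cellwise_sqr_ge]).

    The pull-back is one half of the area formula: if every point of B has at
    least n preimages and the slopes are at most L, then n times the measure of
    B is at most L times the measure of the preimage of B. To prove it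
    ([natmul_measure_le_fibres]), cover the preimage E by intervals of total
    length close to the measure of E and subdivide them into pieces shorter
    than a mesh [e]. On the points where phi is K-Lipschitz at scale [e], for a
    given [K > L], the image of each piece lies in an interval at most K times
    as long as the piece. The sum of the indicators of these intervals has
    integral at most about K times the measure of E
    ([separated_fibre_count]), and, as [e] tends to 0, it is eventually at least
    n at every point of B, since n distinct preimages end up in n different
    pieces. Fatou's lemma concludes. In this argument images of measurable sets
    are only enclosed in intervals, so that their measurability is never at
    stake. The same inequality with n = 1 shows that the image of a set where
    the derivative vanishes is null, so that L is positive
    ([slope_bound_gt0]).

    The inequality between measures says that n times the Lebesgue measure on J
    is at most L times the image by phi of the Lebesgue measure, and it passes
    to integrals of nonnegative Borel functions
    ([natmul_integral_le_preimage]). Applying it for every n that is at most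
    the smallest cardinal of a fibre gives the explicit constant, also when all
    the fibres over J are infinite. *)

Set Implicit Arguments.
Unset Strict Implicit.
Unset Printing Implicit Defensive.

(** * Covering and counting points of fibres *)

Lemma small_diameter_sub_itv (R : realType) (S : set R) (d : R) :
  (forall s t, S s -> S t -> `|s - t| <= d) ->
  exists c, S `<=` `[c, c + d].
Proof.
move=> dS; have [[s0 Ss0]|S0] := pselect (S !=set0); last first.
  by exists 0 => s Ss; case: S0; exists s.
have lbS s : S s -> lbound S (s - d).
  move=> Ss t St; have := dS _ _ Ss St; rewrite ler_norml => /andP[_ h]; lra.
exists (inf S) => s Ss; rewrite /= in_itv /=; apply/andP; split.
  by apply: ge_inf => //; exists (s0 - d); exact: lbS.
by rewrite -lerBlDr; apply: lb_le_inf; [exists s0 | exact: lbS].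
Qed.

(** The outer measure is an infimum over such covers; empty members are
    rewritten as degenerate intervals so that every length is a difference of
    end points. *)
Lemma itv_cover_near_measure (R : realType) (E : set R) (d : R) :
  (lebesgue_measure E < +oo)%E -> 0 < d ->
  exists ab : nat -> R * R,
    [/\ forall i, (ab i).1 <= (ab i).2,
        E `<=` \bigcup_i `](ab i).1, (ab i).2]%classic &
        (\sum_(0 <= i <oo) ((ab i).2 - (ab i).1)%:E <=
          lebesgue_measure E + d%:E)%E].
Proof.
move=> Efin d0.
have Efn : (lebesgue_measure E : \bar R) \is a fin_num.
  by rewrite ge0_fin_numE //; exact: outer_measure_ge0.
have [_ [F [mF EF] <-] ltF] := lb_ereal_inf_adherent d0 Efn.
have /choice[ab abP] i : exists ab : R * R,
    ab.1 <= ab.2 /\ F i = `]ab.1, ab.2]%classic.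
  have /ocitvP[Fi|[[a b] /= ab Fi]] := mF i.
    by exists (0, 0); split; rewrite ?lexx // Fi set_itvoc0.
  by exists (a, b); split=> //; exact: ltW.
exists ab; split=> [i|x Ex|]; first by case: (abP i).
  have [i _ Fix] := EF x Ex; exists i => //.
  by case: (abP i) => _ <-.
apply/ltW/(le_lt_trans _ ltF).
apply: lee_nneseries => [i _ _|i _]; first by rewrite lee_fin subr_ge0; case: (abP i).
case: (abP i) => le ->.
by have := @wlength_itv_bnd R idfun _ _ false false le => /= ->.
Qed.

Lemma mem_subdivision (R : realType) (a b x : R) (p : nat) :
  (0 < p)%N -> x \in `]a, b] ->
  exists2 j, (j < p)%N &
    x \in `]a + j%:R * ((b - a) / p%:R), a + j.+1%:R * ((b - a) / p%:R)].
Proof.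
move=> p0; rewrite in_itv /= => /andP[ax xb].
have ex : exists m : nat, x <= a + m%:R * ((b - a) / p%:R).
  exists p; rewrite mulrCA divff ?mulr1 ?pnatr_eq0 -?lt0n //; lra.
have ltp : x <= a + p%:R * ((b - a) / p%:R).
  rewrite mulrCA divff ?mulr1 ?pnatr_eq0 -?lt0n //; lra.
case: (ex_minnP ex) => -[|m] xm minm.
  by move: xm; rewrite mul0r addr0 leNgt ax.
exists m; first exact: minm.
rewrite in_itv /= xm andbT ltNge; apply/negP => /minm; by rewrite ltnn.
Qed.

(** At most one point of [s] lies in D, and if there is one then [1 <= v]: this
    compares the points of a fibre in one piece of the domain with the indicator
    of the interval that encloses the image of the piece. *)
Lemma sum_indic_le1 (R : realType) (T : eqType) (s : seq T) (D : set T)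
    (v : R) :
  uniq s -> 0 <= v -> {in s &, forall x x', D x -> D x' -> x = x'} ->
  {in s, forall x, D x -> 1 <= v} ->
  \sum_(x <- s) \1_D x <= v :> R.
Proof.
move=> us v0 injD Dv.
have [[x xs Dx]|noD] := pselect (exists2 x, x \in s & D x); last first.
  rewrite big_seq big1 // => x xs; rewrite indicE memNset // => Dx.
  by apply: noD; exists x.
rewrite (bigD1_seq x) //= [X in _ + X]big1_seq ?addr0.
  by rewrite indicE mem_set // (Dv x).
move=> x' /andP[x'x x's]; rewrite indicE memNset // => Dx'.
by move/eqP: x'x; apply; exact: injD.
Qed.

Lemma integral_indic_itv (R : realType) (c d : R) : 0 <= d ->
  (\int[lebesgue_measure]_y (\1_(`[c, (c + d)%R]%classic) y)%:E = d%:E)%E.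
Proof.
move=> d0; rewrite integral_indic //= setIT lebesgue_measure_itv /= lte_fin ltrDl.
case: ltP => [_|dle0]; first by rewrite -EFinB; congr EFin; ring.
by congr EFin; apply/esym/le_anti; rewrite dle0.
Qed.

(** The function [f] is the sum of the indicators of intervals enclosing the
    images of small pieces of E. Two points of [s] are too far apart to lie in
    one piece, and every piece that contains a point of the fibre of [y]
    contributes 1 to [f y], so that [f y] counts at least the points of [s]. *)
Lemma separated_fibre_count (R : realType) (phi : R -> R) (G E : set R)
    (K e d : R) :
  0 <= K -> 0 < e -> 0 < d -> (lebesgue_measure E < +oo)%E -> G `<=` E ->
  (forall x y, G x -> G y -> `|y - x| < e ->
     `|phi y - phi x| <= K * `|y - x|) ->
  exists f : R -> \bar R,
    [/\ measurable_fun [set: measurableTypeR R] f,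
        forall y, (0 <= f y)%E,
        (\int[lebesgue_measure]_y f y <=
           K%:E * (lebesgue_measure E + d%:E))%E &
        forall y (s : seq R), uniq s ->
          (forall x, x \in s -> G x /\ phi x = y) ->
          {in s &, forall x x', `|x - x'| < e -> x = x'} ->
          ((size s)%:R%:E <= f y)%E].
Proof.
move=> K0 e0 d0 Efin GE lip.
have [ab [ab_le Eab sum_ab]] := itv_cover_near_measure Efin d0.
pose len i := (ab i).2 - (ab i).1.
(* The i-th covering interval is cut into [p i] pieces [D i j] of length
   [w i < e]. *)
pose p i := (Num.truncn (len i / e)).+1.
pose w i := len i / (p i)%:R.
have len0 i : 0 <= len i by rewrite subr_ge0.
have w0 i : 0 <= w i by rewrite divr_ge0.
have we i : w i < e.
  by rewrite ltr_pdivrMr // mulrC -ltr_pdivrMr // truncnS_gt.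
pose D i j : set R :=
  `](ab i).1 + j%:R * w i, (ab i).1 + j.+1%:R * w i]%classic.
have Dw i j x x' : D i j x -> D i j x' -> `|x - x'| <= w i.
  rewrite /D /= !in_itv /= -[j.+1]addn1 natrD mulrDl mul1r.
  move=> /andP[? ?] /andP[? ?]; rewrite ler_norml; apply/andP; split; lra.
have /choice[c cP] ij : exists c, phi @` (G `&` D ij.1 ij.2) `<=`
    `[c, c + K * w ij.1].
  apply: small_diameter_sub_itv => _ _ [x [Gx Dx] <-] [x' [Gx' Dx'] <-].
  have xx' := Dw _ _ _ _ Dx Dx'.
  apply: (le_trans (lip _ _ Gx' Gx _)); first exact: le_lt_trans xx' (we _).
  exact: ler_wpM2l.
(* [H i j] encloses the image of the piece [D i j]. *)
pose H i j : set R := `[c (i, j), c (i, j) + K * w i]%classic.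
have mH i j : measurable (H i j) by exact: measurable_itv.
pose t i y : R := \sum_(j < p i) \1_(H i j) y.
have t0 i y : 0 <= t i y by apply: sumr_ge0 => j _; rewrite indicE.
have mt i : measurable_fun [set: measurableTypeR R] (t i).
  apply: measurable_sum => j.
  by apply: measurable_indic; exact: mH.
exists (fun y => \sum_(0 <= i <oo) (t i y)%:E)%E; split.
- apply: ge0_emeasurable_sum => [i y _ _|i _]; first by rewrite lee_fin.
  exact/measurable_EFinP.
- by move=> y; apply: nneseries_ge0 => i _ _; rewrite lee_fin.
- rewrite integral_nneseries //; last 2 first.
  + by move=> i; exact/measurable_EFinP.
  + by move=> i y _; rewrite lee_fin.
  have intt i : (\int[lebesgue_measure]_y (t i y)%:E = K%:E * (len i)%:E)%E.
    under eq_integral do rewrite /t -sumEFin.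
    rewrite ge0_integral_sum //; last first.
      by move=> j; apply/measurable_EFinP; apply: measurable_indic; exact: mH.
    transitivity (\sum_(j < p i) (K * w i)%:E)%E.
      by apply: eq_bigr => j _; apply: integral_indic_itv; exact: mulr_ge0.
    rewrite sumEFin -EFinM; congr EFin; rewrite sumr_const card_ord -mulr_natr.
    by rewrite /w -mulrA divfK // pnatr_eq0.
  under eq_eseriesr do rewrite intt.
  rewrite nneseriesZl; last by move=> i _; rewrite lee_fin.
  by rewrite lee_wpmul2l ?lee_fin.
- move=> y s us sG sep.
  (* [q i x] is [t i] with the pieces in place of the intervals that enclose
     their images: the pieces cover E, so each point of [s] is counted, and on
     each piece [sum_indic_le1] applies. *)
  pose q i x : R := \sum_(j < p i) \1_(D i j) x.
  have q0 i x : 0 <= q i x by apply: sumr_ge0 => j _; rewrite indicE.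
  have q1 x : x \in s -> (1 <= \sum_(0 <= i <oo) (q i x)%:E)%E.
    move=> /sG[Gx _]; have [i _ xi] := Eab x (GE x Gx).
    have [//|j jp xij] := @mem_subdivision R _ _ x (p i) _ xi.
    rewrite (nneseriesD1 (n := i)) //; last by move=> k _; rewrite lee_fin.
    rewrite -[leLHS]adde0 leeD //; last first.
      by apply: nneseries_ge0 => k _ _; rewrite lee_fin.
    rewrite lee_fin /q (bigD1 (Ordinal jp)) //= indicE mem_set //=.
    by rewrite lerDl sumr_ge0 // => k _; rewrite indicE.
  apply: (@le_trans _ _ (\sum_(x <- s) \sum_(0 <= i <oo) (q i x)%:E)%E).
    rewrite -[in leLHS](@sum1_size _ s) natr_sum -sumEFin !big_seq.
    by apply: lee_sum => x xs; exact: q1.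
  rewrite -nneseries_sum; last by move=> x i _; rewrite lee_fin.
  apply: lee_nneseries => [i _ _|i _].
    by apply: sume_ge0 => x _; rewrite lee_fin.
  rewrite sumEFin lee_fin exchange_big /=; apply: ler_sum => j _.
  apply: sum_indic_le1 => //.
    by move=> x x' xs x's Dx Dx'; apply: sep => //; exact: le_lt_trans (Dw _ _ _ _ Dx Dx') (we i).
  move=> x xs Dx; rewrite indicE mem_set //.
  by have [Gx <-] := sG _ xs; apply: (cP (i, nat_of_ord j)); exists x.
Qed.

(** * The measure of a set with large fibres *)

(** The integral of a nonnegative function is a supremum over the simple
    functions below it, hence monotone for arbitrary integrands. This generality
    matters: the composition of a Lebesgue measurable [fl] with a continuous
    [phi] can fail to be measurable. *)
Lemma ge0_le_integral_restrict d (T : measurableType d) (R : realType)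
    (mu : {measure set T -> \bar R}) (D D' : set T) (f g : T -> \bar R) :
  (forall x, D x -> 0 <= f x)%E -> (forall x, D' x -> 0 <= g x)%E ->
  (forall x, (f \_ D) x <= (g \_ D') x)%E ->
  (\int[mu]_(x in D) f x <= \int[mu]_(x in D') g x)%E.
Proof.
move=> f0 g0 fg; rewrite !ge0_integralE //; apply: ereal_sup_le => _ [h hf <-].
by exists h => // x; exact: le_trans (hf x) (fg x).
Qed.

(** A consequence of Fatou's lemma: on B the lower limit of the [f k] is at least
    n. *)
Lemma integral_eventually_ge d (T : measurableType d) (R : realType)
    (mu : {measure set T -> \bar R}) (f : nat -> T -> \bar R) (B : set T)
    (n : nat) (a : \bar R) :
  measurable B -> (forall k, measurable_fun setT (f k)) ->
  (forall k x, 0 <= f k x)%E ->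
  (forall x, B x -> \forall k \near \oo, (n%:R%:E <= f k x)%E) ->
  (\forall k \near \oo, (\int[mu]_x f k x <= a)%E) ->
  (n%:R%:E * mu B <= a)%E.
Proof.
move=> mB mf f0 Bf fa.
have -> : (n%:R%:E * mu B = \int[mu]_(x in B) (cst n%:R%:E) x)%E.
  by rewrite integral_cst.
apply: (@le_trans _ _ (\int[mu]_x limn_einf (f^~ x))%E).
  have le0 x : (0 <= limn_einf (f^~ x))%E.
    rewrite limn_einf_lim; apply: lime_ge; first exact: is_cvg_einfs.
    by apply: nearW => k; apply: le_ereal_inf_tmp => _ [m _ <-].
  apply: ge0_le_integral_restrict => [x _|x _|x] //; first by rewrite lee_fin.
  rewrite patch_setT /patch; case: ifPn => // /[!inE] Bx.
  rewrite limn_einf_lim; apply: lime_ge; first exact: is_cvg_einfs.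
  have [N _ NP] := Bf x Bx; exists N => // k /= Nk.
  apply: le_ereal_inf_tmp => _ [m /= km <-]; apply: NP => /=.
  exact: leq_trans km.
apply: (le_trans (fatou mu measurableT mf (fun k x _ => f0 k x))).
rewrite limn_einf_lim; apply: lime_le; first exact: is_cvg_einfs.
near=> k; apply: (@le_trans _ _ (\int[mu]_x f k x)%E); last by near: k.
by apply: ereal_inf_lbound; exists k => /=.
Unshelve. all: by end_near. Qed.

Lemma near_all_seq (T : eqType) (I : Type) (F : set_system I) {FF : Filter F}
    (s : seq T) (P : T -> I -> Prop) :
  (forall x, x \in s -> \forall i \near F, P x i) ->
  \forall i \near F, forall x, x \in s -> P x i.
Proof.
elim: s => [_|x s IHs Ps]; first exact: nearW.
have {}IHs : \forall i \near F, forall y, y \in s -> P y i.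
  by apply: IHs => y ys; apply: Ps; rewrite in_cons ys orbT.
have Px : \forall i \near F, P x i by apply: Ps; exact: mem_head.
apply: filterS2 Px IHs => i Pxi Psi y; rewrite in_cons => /predU1P[->//|].
exact: Psi.
Qed.

(** One half of the area formula, for outer measures. The points where phi is
    K-Lipschitz at scale [k.+1%:R^-1] exhaust E as k grows, and any n points of
    a fibre are eventually separated at this scale, so that the functions given
    by [separated_fibre_count] are eventually at least n on B. *)
Lemma natmul_measure_le_fibres (R : realType) (phi : R -> R) (E B : set R)
    (K : R) (n : nat) :
  0 < K ->
  (forall x, E x -> exists2 e, 0 < e & forall y, E y -> `|y - x| < e ->
     `|phi y - phi x| <= K * `|y - x|) ->
  (forall y, B y -> exists s : seq R,
     [/\ uniq s, size s = n & forall x, x \in s -> E x /\ phi x = y]) ->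
  (n%:R%:E * lebesgue_measure B <= K%:E * lebesgue_measure E)%E.
Proof.
move=> K0 lipE fibB.
have [Efin|] := ltP (lebesgue_measure E : \bar R) +oo%E; last first.
  by rewrite leye_eq => /eqP ->; rewrite gt0_muley ?lte_fin // leey.
have Efn : (lebesgue_measure E : \bar R) \is a fin_num.
  by rewrite ge0_fin_numE //; exact: outer_measure_ge0.
pose e k : R := k.+1%:R^-1.
have e0 k : 0 < e k by rewrite invr_gt0.
pose G k : set R := [set x | E x /\ forall y, E y -> `|y - x| < e k ->
     `|phi y - phi x| <= K * `|y - x|].
have /choice[f fP] k := @separated_fibre_count R phi (G k) E K (e k) (e k)
  (ltW K0) (e0 k) (e0 k) Efin (fun x => @proj1 _ _)
  (fun x y Gx Gy => Gx.2 y Gy.1).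
(* A Borel set that contains B, on which the [f k] are eventually at least n. *)
pose H : set R :=
  \bigcup_N \bigcap_(k in [set k | (N <= k)%N]) [set y | (n%:R%:E <= f k y)%E].
have mH : measurable (H : set (measurableTypeR R)).
  apply: bigcupT_measurable => N; apply: bigcap_measurable.
    by exists N => /=.
  move=> k _; have [mfk _ _ _] := fP k.
  rewrite -[X in measurable X]setTI.
  by apply: emeasurable_fun_c_infty.
have BH : B `<=` H.
  move=> y /fibB[s [us sn sE]].
  have sepE (x x' : R) : \forall k \near \oo, `|x - x'| < e k -> x = x'.
    have [->|xx'] := eqVneq x x'; first exact: nearW.
    have d0 : 0 < `|x - x'| by rewrite normr_gt0 subr_eq0.
    near=> k => lt; exfalso; have : e k < `|x - x'|.
      by near: k; exact: (near_infty_natSinv_lt (PosNum d0)).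
    by rewrite ltNge (ltW lt).
  have GE (x : R) : x \in s -> \forall k \near \oo, G k x.
    move=> /sE[Ex _]; have [d d0 dP] := lipE x Ex.
    near=> k; split=> // y' Ey' lt; apply: dP => //; apply: (lt_trans lt).
    by near: k; exact: (near_infty_natSinv_lt (PosNum d0)).
  have sepS : \forall k \near \oo,
      forall x, x \in s -> forall x', x' \in s -> `|x - x'| < e k -> x = x'.
    by apply: near_all_seq => x _; apply: near_all_seq => x' _; exact: sepE.
  have GS := near_all_seq GE.
  suff [N _ NP] : \forall k \near \oo, (n%:R%:E <= f k y)%E by exists N.
  near=> k; have Gk : forall x, x \in s -> G k x.
    by near: k; exact: GS.
  rewrite -sn; case: (fP k) => _ _ _; apply => // [x xs|x x' xs x's].
    by split; [exact: Gk | case: (sE x xs)].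
  by move: x xs x' x's; near: k; exact: sepS.
apply: (@le_trans _ _ (n%:R%:E * lebesgue_measure H)%E).
  by rewrite lee_wpmul2l ?lee_fin //; exact: le_outer_measure.
apply/lee_addgt0Pr => eps eps0.
apply: (@integral_eventually_ge _ _ _ (@lebesgue_measure R) f) => //.
- by move=> k; case: (fP k).
- by move=> k; case: (fP k).
- have d0 : 0 < eps / K by rewrite divr_gt0.
  near=> k; case: (fP k) => _ _ /le_trans + _; apply.
  rewrite muleDr ?fin_num_adde_defr //.
  rewrite leeD2l // -EFinM lee_fin mulrC -ler_pdivlMr // ltW //.
  by near: k; exact: (near_infty_natSinv_lt (PosNum d0)).
Unshelve. all: by end_near. Qed.

(** * Functions differentiable along a set *)

Lemma C1_pointwise_lipschitz (R : realType) (X : set R) (phi dphi : R -> R)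
    (x K : R) :
  is_C1_on X phi dphi -> X x -> `|dphi x| < K ->
  exists2 e, 0 < e & forall y, X y -> `|y - x| < e ->
    `|phi y - phi x| <= K * `|y - x|.
Proof.
move=> [der _] Xx dK.
have d0 : 0 < K - `|dphi x| by rewrite subr_gt0.
have /cvgrPdist_lt/(_ _ d0) := der x Xx.
rewrite near_withinE => -[e /= e0 He].
exists e => // y Xy yxe.
have [->|yx] := eqVneq y x; first by rewrite !subrr normr0 mulr0.
have yx0 : y - x != 0 by rewrite subr_eq0.
have := He y; rewrite /ball /= distrC => /(_ yxe yx Xy) lt.
have : `|(phi y - phi x) / (y - x)| < K.
  have := ler_normB (dphi x) (dphi x - (phi y - phi x) / (y - x)).
  by rewrite opprB addrC subrK => /le_lt_trans; apply; rewrite -ltrBrDl.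
by rewrite normrM normfV ltr_pdivrMr ?normr_gt0 // => /ltW.
Qed.

(** The pointwise Lipschitz bound makes phi continuous along X, so that the
    preimage in X of an open set is the trace on X of an open set. *)
Lemma C1_measurable (R : realType) (X : set R) (phi dphi : R -> R) :
  lebesgue_measurable_set X -> is_C1_on X phi dphi ->
  measurable_fun (X : set (lebesgueTypeR R)) (phi : _ -> measurableTypeR R).
Proof.
move=> mX C1.
have cphi : {within X, continuous phi}.
  apply/subspace_continuousP => x Xx; apply/cvgrPdist_lt => eps eps0.
  have K0 : 0 < `|dphi x| + 1 by rewrite ltr_pwDr.
  have [e e0 eP] := C1_pointwise_lipschitz C1 Xx (ltr_pwDr ltr01 (lexx _)).
  rewrite near_withinE; near=> y => Xy; rewrite distrC.
  have lt : `|y - x| < Num.min e (eps / (`|dphi x| + 1)).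
    rewrite distrC; near: y; apply: nbhsx_ballx.
    by rewrite lt_min e0 divr_gt0.
  move: lt; rewrite lt_min => /andP[lt1 lt2].
  apply: le_lt_trans (eP y Xy lt1) _.
  by rewrite mulrC -ltr_pdivlMr.
apply: (measurability _ (RGenOpens.measurableE R)).
move=> _ [_ [a [b ->] <-]].
have /continuousP/(_ _ (@interval_open _ (BRight a) (BLeft b) isT isT)) := cphi.
move=> /open_subspaceP[V oV VX].
rewrite setIC -VX; apply: measurableI => //.
by apply: sub_caratheodory; exact: open_measurable.
Unshelve. all: by end_near. Qed.

Lemma le_mule_of_gt (R : realType) (a b : \bar R) (L : R) :
  0 < L -> (0 <= b)%E -> (forall K, L < K -> (a <= K%:E * b)%E) ->
  (a <= L%:E * b)%E.
Proof.
move=> L0; case: b => [b| |] // b0 H; last by rewrite gt0_muley ?lte_fin // leey.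
apply/lee_addgt0Pr => e e0.
have b1 : 0 < b + 1 by rewrite ltr_wpDl // -lee_fin.
apply: (le_trans (H (L + e / (b + 1)) _)); first by rewrite ltrDl divr_gt0.
rewrite -!EFinM -EFinD lee_fin mulrDl lerD2l mulrAC ler_pdivrMr //.
by rewrite ler_wpM2l ?ltW // ltrDl.
Qed.

Section fibres.
Context (R : realType) (X J : set R) (phi dphi : R -> R) (L : R).
Hypothesis phiC1 : is_C1_on X phi dphi.
Hypothesis dphiL : forall x, preimage_in X phi J x -> `|dphi x| <= L.

(* Restricting phi to a subset of X keeps the Lipschitz bound, because
   difference quotients are taken along X only. *)
Let lip K E : L < K -> E `<=` preimage_in X phi J ->
  forall x, E x -> exists2 e, 0 < e & forall y, E y -> `|y - x| < e ->
     `|phi y - phi x| <= K * `|y - x|.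
Proof.
move=> LK EJ x Ex.
have [|e e0 eP] := C1_pointwise_lipschitz (x := x) (K := K) phiC1 (EJ _ Ex).1.
  by apply: (le_lt_trans _ LK); apply: dphiL; exact: EJ.
by exists e => // y /EJ[Xy _]; exact: eP.
Qed.

(** Were L nonpositive, the derivative would vanish on the preimage of J, and phi
    would map every bounded part of it to a null set, by
    [natmul_measure_le_fibres] with n = 1 and arbitrarily small K. Then J would
    be null, although it is open and nonempty. *)
Lemma slope_bound_gt0 : open J -> J !=set0 -> J `<=` phi @` X -> 0 < L.
Proof.
move=> oJ [y0 Jy0] Jphi; rewrite ltNge; apply/negP => L0.
pose A (j : nat) : set R := preimage_in X phi J `&` `[- j%:R, j%:R].
have lA j : lebesgue_measure (phi @` A j) = 0%E.
  apply/eqP; rewrite eq_le outer_measure_ge0 andbT.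
  apply/lee_addgt0Pr => e e0; rewrite add0e.
  have j0 : 0 < j%:R *+ 2 + 1 :> R by rewrite ltr_wpDl.
  (* The part [A j] has measure at most [2 * j], so this Lipschitz constant
     makes the measure of its image less than [e]. *)
  have K0 : 0 < e / (j%:R *+ 2 + 1) by rewrite divr_gt0.
  have AJ : A j `<=` preimage_in X phi J by move=> x [].
  have := @natmul_measure_le_fibres R phi (A j) (phi @` A j) _ 1 K0
    (lip (le_lt_trans L0 K0) AJ).
  rewrite mul1e => /(_ _)/le_trans; apply.
    by move=> _ [x Ax <-]; exists [:: x]; split => // x'; rewrite inE => /eqP->.
  apply: (@le_trans _ _ ((e / (j%:R *+ 2 + 1))%:E * (j%:R *+ 2)%:E)%E).
    apply: lee_wpmul2l; first by rewrite lee_fin ltW.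
    apply: (@le_trans _ _ (lebesgue_measure (`[- j%:R, j%:R]%classic : set R))).
      by apply: le_outer_measure => x [].
    rewrite lebesgue_measure_itv /= lte_fin; case: ltP => // _.
    by rewrite -EFinB opprK lee_fin mulr2n.
  rewrite -EFinM lee_fin mulrAC ler_pdivrMr // ler_wpM2l ?ltW //.
  by rewrite ltrDl.
have : (lebesgue_measure J <= 0)%E.
  have JA : J `<=` \bigcup_j (phi @` A j).
    move=> y Jy; have [x Xx xy] := Jphi y Jy.
    exists (Num.truncn `|x|).+1 => //; exists x => //; split.
      by split=> //=; rewrite xy.
    by rewrite /= in_itv /= -ler_norml ltW // truncnS_gt.
  apply: (le_trans (le_outer_measure ((@wlength R idfun)^*)%mu _ _ JA)).
  apply: (le_trans (outer_measure_sigma_subadditive ((@wlength R idfun)^*)%mu _)).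
  by rewrite eseries0 // => j _ _; exact: lA.
apply/negP; rewrite -ltNge.
have /nbhs_ballP[e /= e0 eJ] : nbhs y0 J by exact: open_nbhs_nbhs.
apply: (@lt_le_trans _ _ (lebesgue_measure (ball y0 e))).
  by rewrite lebesgue_measure_ball ?ltW // lte_fin pmulrn_lgt0.
exact: le_outer_measure.
Qed.

(** [natmul_measure_le_fibres] holds with every constant larger than L, and L is
    their infimum; positivity of L covers preimages of infinite measure. *)
Lemma natmul_measure_le_preimage (n : nat) (B : set R) :
  0 < L -> B `<=` J ->
  (forall y, J y -> exists s : seq R,
     [/\ uniq s, size s = n & forall x, x \in s -> X x /\ phi x = y]) ->
  (n%:R%:E * lebesgue_measure B <=
     L%:E * lebesgue_measure (preimage_in X phi B))%E.
Proof.
move=> L0 BJ fib.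
apply: le_mule_of_gt => // K LK.
apply: (natmul_measure_le_fibres (phi := phi)); first exact: lt_trans LK.
  by apply: lip => // x [Xx /BJ].
move=> y By; have [s [us sn sX]] := fib y (BJ _ By).
exists s; split => // x /sX[Xx xy]; split=> //; split=> //=.
by rewrite /preimage /= xy.
Qed.

End fibres.

(** * Transfer of integrals to the preimage *)

Lemma integral_mrestr d (T : measurableType d) (R : realType)
    (mu : {measure set T -> \bar R}) (D : set T) (mD : measurable D)
    (f : T -> \bar R) :
  (\int[mrestr mu mD]_(x in D) f x = \int[mu]_(x in D) f x)%E.
Proof.
by apply: eq_measure_integral => A mA AD; rewrite /= /mrestr setIidl.
Qed.

Section transfer.
Context (R : realType) (X J : set R) (phi dphi : R -> R) (L : R) (n : nat).
Hypothesis mX : lebesgue_measurable_set X.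
Hypothesis phiC1 : is_C1_on X phi dphi.
Hypothesis dphiL : forall x, preimage_in X phi J x -> `|dphi x| <= L.
Hypothesis L0 : 0 < L.
Hypothesis mJ : measurable (J : set (measurableTypeR R)).
Hypothesis J0 : ~ J 0.
Hypothesis fib : forall y, J y -> exists s : seq R,
  [/\ uniq s, size s = n & forall x, x \in s -> X x /\ phi x = y].

(* Extending phi by 0 outside X makes it a function on the whole line, and does
   not change the preimages of the subsets of J, because J does not contain 0. *)
Local Notation psi := (phi \_ X : lebesgueTypeR R -> measurableTypeR R).

Let mpsi : measurable_fun [set: lebesgueTypeR R] psi.
Proof. exact: (measurable_restrictT _ mX).1 (C1_measurable mX phiC1). Qed.

Let psiE B : B `<=` J -> psi @^-1` B = preimage_in X phi B.
Proof.
move=> BJ; apply/seteqP; split=> x; rewrite /preimage /= patchE; case: ifPn.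
- by rewrite inE.
- by move=> _ /BJ.
- by move=> _ [].
- by rewrite notin_setE => nX [].
Qed.

(** The measures [m1], n times Lebesgue measure on J, and [m2], L times the image
    measure under phi, satisfy [m1 <= m2] on Borel sets by
    [natmul_measure_le_preimage], so their integrals compare as well. *)
Lemma natmul_integral_le_preimage (g : R -> \bar R) :
  measurable_fun [set: measurableTypeR R] g -> (forall y, 0 <= g y)%E ->
  (n%:R%:E * \int[lebesgue_measure]_(y in J) g y <=
   L%:E * \int[completed_lebesgue_measure]_(x in preimage_in X phi J)
     g (phi x))%E.
Proof.
move=> mg g0.
pose m1 := mscale (NngNum (ler0n R n)) (mrestr (@lebesgue_measure R) mJ).
(* The image measure as a bundled measure: its structure depends on the proof
   that psi is measurable, which is not inferred and is given explicitly. *)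
pose nu : {measure set (measurableTypeR R) -> \bar R} :=
  measure_function_pushforward__canonical__measure_function_Measure
    (@completed_lebesgue_measure R) mpsi.
pose m2 := mscale (NngNum (ltW L0)) nu.
have m12 S : measurable S -> (m1 S <= m2 S)%E.
  move=> mS.
  have SJ : S `&` J `<=` J by move=> x [].
  apply: (@le_trans _ _ (m2 (S `&` J))).
    rewrite /m1 /m2 /mscale /mrestr /nu /= /pushforward psiE //.
    exact: (natmul_measure_le_preimage phiC1 dphiL).
  by apply: le_measure; rewrite ?inE //; exact: measurableI.
have := ge0_le_measure_integral m12 mJ g0 mg.
have mgJ : measurable_fun (J : set (measurableTypeR R)) g.
  exact: measurable_funTS.
rewrite !ge0_integral_mscale // integral_mrestr.
rewrite (ge0_integral_pushforward mpsi) // psiE //.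
move=> /le_trans; apply; apply: lee_wpmul2l; first by rewrite lee_fin ltW.
apply: ge0_le_integral_restrict => [x _|x _|x] //; first exact: g0.
rewrite /patch; case: ifPn => //.
by rewrite inE => -[Xx _] /=; rewrite (mem_set Xx).
Qed.

End transfer.

(** * The mean squared error on a part of a cell *)

Lemma integral_sqr_itv (R : realType) (r p q : R) : p < q ->
  (\int[lebesgue_measure]_(y in `]p, q[) ((y - r) ^+ 2)%:E =
   (((q - r) ^+ 3 - (p - r) ^+ 3) / 3)%:E)%E.
Proof.
move=> pq; pose F := fun y : R => (y - r) ^+ 3 / 3.
have dF (y : R) : is_derive y (1 : R) F ((y - r) ^+ 2).
  by rewrite /F; apply: is_derive_eq; rewrite /GRing.scale /=; field.
have cF : continuous F.
  by move=> y; apply/differentiable_continuous/derivable1_diffP; case: (dF y).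
have cf : continuous (fun y : R => (y - r) ^+ 2).
  by move=> y; apply/differentiable_continuous/derivable1_diffP; exact: ex_derive.
rewrite -(@integral_itv_bndoo _ _ _ _ true false); last first.
  by apply/measurable_EFinP; exact: open_continuous_measurable_fun.
rewrite (@continuous_FTC2 _ _ F) //.
- by rewrite -EFinB /F; congr EFin; field.
- by apply: continuous_subspaceT.
- split=> [y _||]; first by case: (dF y).
  + exact/cvg_at_right_filter/cF.
  + exact/cvg_at_left_filter/cF.
- by move=> y _; rewrite derive1E; have [_ ->] := dF y.
Qed.

(** With [z] the coordinate, relative to r, of the end point opposite to the
    shared one, say [r + h], the mean of the square is [(z^2 + z * h + h^2) / 3].
    This is at least [h^2 / 4], with equality at [z = - h / 2]. *)
Lemma integral_sqr_end_ge (R : realType) (r h p q : R) :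
  p < q -> r - h <= p -> q <= r + h -> p = r - h \/ q = r + h ->
  ((h ^+ 2 / 4 * (q - p))%:E <=
   \int[lebesgue_measure]_(y in `]p, q[) ((y - r) ^+ 2)%:E)%E.
Proof.
move=> pq hp qh H; rewrite integral_sqr_itv // lee_fin ler_pdivlMr //.
case: H => [pE|qE].
  have -> : (q - r) ^+ 3 - (p - r) ^+ 3 =
     (q - p) * ((q - r) ^+ 2 - (q - r) * h + h ^+ 2) by rewrite pE; ring.
  rewrite [leLHS](_ : _ = (q - p) * (3 / 4 * h ^+ 2)); last by field.
  apply: ler_wpM2l; first by rewrite subr_ge0 ltW.
  have := sqr_ge0 ((q - r) - h / 2); nra.
have -> : (q - r) ^+ 3 - (p - r) ^+ 3 =
   (q - p) * ((p - r) ^+ 2 + (p - r) * h + h ^+ 2) by rewrite qE; ring.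
rewrite [leLHS](_ : _ = (q - p) * (3 / 4 * h ^+ 2)); last by field.
apply: ler_wpM2l; first by rewrite subr_ge0 ltW.
have := sqr_ge0 ((p - r) + h / 2); nra.
Qed.

(** The interval is longer than the cell, so their intersection reaches an end
    point of the cell and [integral_sqr_end_ge] applies. *)
Lemma integral_sqr_cell_ge (R : realType) (r h a b : R) :
  2 * h < b - a ->
  ((h ^+ 2 / 4)%:E * lebesgue_measure (`]a, b[ `&` `](r - h)%R, (r + h)%R[) <=
   \int[lebesgue_measure]_(y in `]a, b[ `&` `](r - h)%R, (r + h)%R[)
     ((y - r) ^+ 2)%:E)%E.
Proof.
move=> hab.
pose p := Num.max a (r - h); pose q := Num.min b (r + h).
have -> : `]a, b[ `&` `]r - h, (r + h)[ = `]p, q[%classic.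
  apply/seteqP; split => y /=; rewrite !in_itv /= /p /q gt_max lt_min.
    by move=> [/andP[-> ->] /andP[-> ->]].
  by move=> /andP[/andP[-> ->] /andP[-> ->]].
have [pq|qp] := ltP p q; last first.
  by rewrite set_itv_ge ?bnd_simp -?leNgt // measure0 mule0 integral_set0.
rewrite lebesgue_measure_itv /= lte_fin pq -EFinB -EFinM.
apply: integral_sqr_end_ge => //.
- by rewrite le_max lexx orbT.
- by rewrite ge_min lexx orbT.
- rewrite /p /q; move: pq; rewrite /p /q.
  case: (leP a (r - h)) => [|ra]; first by left.
  case: (leP b (r + h)) => [bh _|_ _]; [lra | by right].
Qed.

(** * Norms, cells and null end points *)

Lemma L2normE (R : realType) (D : set R) (f : R -> R) :
  (L2norm D f ^+ 2 =
   \int[completed_lebesgue_measure]_(x in D) ((f x) ^+ 2)%:E)%E.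
Proof.
have sqrE (x : \bar R) : (0 <= x -> x ^+ 2 = x `^ 2)%E.
  case: x => [x| |] //; last by rewrite poweRyr.
  by rewrite lee_fin poweR_EFin => x0; rewrite expe2 -EFinM -expr2 -powR_mulrn.
rewrite /L2norm sqrE ?Lnorm_ge0 // poweR_Lnorm //.
rewrite [RHS]integral_mkcond; apply: eq_integral => x _.
rewrite /patch; case: ifP => _ /=; last by rewrite normr0 powR0.
by rewrite powR_mulrn // real_normK ?num_real.
Qed.

Lemma L2norm_sub (R : realType) (D D' : set R) (f : R -> R) :
  D `<=` D' -> (L2norm D f ^+ 2 <= L2norm D' f ^+ 2)%E.
Proof.
move=> DD'; rewrite !L2normE.
apply: ge0_le_integral_restrict => [x _|x _|x]; rewrite ?lee_fin ?sqr_ge0 //.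
rewrite /patch; case: ifPn => [/[!inE] /DD' D'x|_]; first by rewrite mem_set.
by case: ifPn => // _; rewrite lee_fin sqr_ge0.
Qed.

(** Subadditivity, for the outer measure and thus without measurability of the
    sets. *)
Lemma outer_measure_seq_cover (R : realType) (T : eqType) (s : seq T)
    (D : set R) (C : T -> set R) :
  D `<=` [set y | exists2 r, r \in s & C r y] ->
  (lebesgue_measure D <= \sum_(r <- s) lebesgue_measure (D `&` C r))%E.
Proof.
elim: s D => [|r s IHs] D Ds.
  rewrite big_nil (_ : D = set0) ?measure0 //.
  by apply/seteqP; split => // y /Ds[].
rewrite big_cons.
have DE : D `<=` (D `&` C r) `|` (D `\` C r).
  by move=> y Dy; have [Cy|nCy] := pselect (C r y); [left|right].
apply: (le_trans (le_outer_measure ((@wlength R idfun)^*)%mu _ _ DE)).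
apply: (le_trans (outer_measureU2 ((@wlength R idfun)^*)%mu _ _)).
apply: leeD => //.
apply: (@le_trans _ _
  (\sum_(r' <- s) lebesgue_measure ((D `\` C r) `&` C r'))%E).
  apply: IHs => y [/Ds[r' + Cy] nCy]; rewrite in_cons => /predU1P[r'r|r's].
    by move: nCy; rewrite -r'r.
  by exists r'.
by apply: lee_sum => r' _; apply: le_outer_measure => y [[]].
Qed.

Lemma cell_itv (R : realType) (u r : R) :
  cell u r = `]r - u * `|r|, r + u * `|r|[%classic.
Proof.
by apply/seteqP; split => y; rewrite /cell /= in_itv /= ltr_distl.
Qed.

Lemma closure_cell_sub (R : realType) (u r : R) :
  closure (cell u r) `<=` `[r - u * `|r|, r + u * `|r|].
Proof.
have /closure_id -> : closed (`[r - u * `|r|, r + u * `|r|] : set R).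
  exact: interval_closed.
by apply: closureS; rewrite cell_itv; exact: subset_itv_oo_cc.
Qed.

Lemma measure_itvcc_sub (R : realType) (D : set R) (a b : R) :
  (lebesgue_measure (D `&` `[a, b]) <= lebesgue_measure (D `&` `]a, b[))%E.
Proof.
have sub : D `&` `[a, b] `<=` (D `&` `]a, b[) `|` [set a; b].
  move=> y [Dy] /=; rewrite in_itv /= !le_eqVlt.
  move=> /andP[/predU1P[ay _|ay /predU1P[yb|yb]]].
  - by right; left.
  - by right; right.
  - by left; split => //=; rewrite in_itv /= ay yb.
apply: (le_trans (le_outer_measure ((@wlength R idfun)^*)%mu _ _ sub)).
apply: (le_trans (outer_measureU2 ((@wlength R idfun)^*)%mu _ _)).
rewrite [X in (_ + X)%E](_ : _ = 0%E) ?adde0 //.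
apply: countable_lebesgue_measure0.
by apply: finite_set_countable; exact: finite_set2.
Qed.

(** * The range of absolute values on an interval *)

Section bounds_of_J.
Context (R : realType) (J : set R).
Hypothesis m_gt0 : 0 < min_abs J.

Lemma min_abs_gt0_nonempty : J !=set0.
Proof.
have [//|] := pselect (J !=set0) => /set0P/negP/negPn/eqP J0.
by move: m_gt0; rewrite /min_abs J0 image_set0 inf0 ltxx.
Qed.

Lemma min_abs_le y : J y -> min_abs J <= `|y|.
Proof.
move=> Jy; apply: ge_inf; last by exists y.
by exists 0 => _ [z _ <-].
Qed.

Lemma min_abs_gt0_notin0 : ~ J 0.
Proof. by move=> /min_abs_le; rewrite normr0 leNgt m_gt0. Qed.

Hypothesis bndJ : has_ubound [set `|y| | y in J].

Lemma le_max_abs y : J y -> `|y| <= max_abs J.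
Proof. by move=> Jy; apply: ub_le_sup => //; exists y. Qed.

(** All elements of J have the same sign, so the distance of two of them is the
    difference of their absolute values. *)
Lemma interval_length_le_abs : is_interval J ->
  interval_length J <= max_abs J - min_abs J.
Proof.
move=> iJ; have J0 := min_abs_gt0_nonempty.
have diff x y : J x -> J y -> x - y <= max_abs J - min_abs J.
  move=> Jx Jy; have := min_abs_le Jx; have := min_abs_le Jy.
  have := le_max_abs Jx; have := le_max_abs Jy.
  have N0 := min_abs_gt0_notin0.
  have [x0|x0] := leP 0 x; have [y0|y0] := leP 0 y.
  - by rewrite (ger0_norm x0) (ger0_norm y0) => *; lra.
  - by have := iJ _ _ Jy Jx 0; rewrite x0 ltW // => /(_ isT)/N0.
  - by have := iJ _ _ Jx Jy 0; rewrite y0 ltW // => /(_ isT)/N0.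
  - by rewrite (ltr0_norm x0) (ltr0_norm y0) => *; lra.
rewrite /interval_length lerBlDl; apply: ge_sup => // x Jx.
rewrite -lerBlDr; apply: lb_le_inf => // y Jy.
by have := diff x y Jx Jy; lra.
Qed.

Lemma open_interval_itv : open J -> is_interval J ->
  J = `]inf J, sup J[%classic.
Proof.
move=> oJ iJ; have J0 := min_abs_gt0_nonempty.
have [ubJ lbJ] : has_ubound J /\ has_lbound J.
  split; [exists (max_abs J)|exists (- max_abs J)] => y /le_max_abs;
  by rewrite ler_norml => /andP[].
apply/seteqP; split => y /=; rewrite in_itv /=.
  move=> Jy; have /nbhs_ballP[e /= e0 eJ] : nbhs y J by exact: open_nbhs_nbhs.
  have he : `|e / 2| < e by rewrite gtr0_norm ?divr_gt0 //; lra.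
  have J1 : J (y - e / 2) by apply: eJ; rewrite /ball /= opprB addrC subrK.
  have J2 : J (y + e / 2).
    by apply: eJ; rewrite /ball /= opprD addrA subrr add0r normrN.
  have := ge_inf lbJ J1; have := ub_le_sup ubJ J2; move=> *; lra.
move=> /andP[iy ys].
have [x1 Jx1 x1y] : exists2 x, J x & x < y.
  rewrite -subr_gt0 in iy; have [x Jx] := inf_adherent iy (conj J0 lbJ).
  by rewrite addrC subrK => xy; exists x.
have [x2 Jx2 x2y] : exists2 x, J x & y < x.
  rewrite -subr_gt0 in ys; have [x Jx] := sup_adherent ys (conj J0 ubJ).
  by rewrite opprB addrC subrK => xy; exists x.
by apply: (iJ _ _ Jx1 Jx2); rewrite (ltW x1y) (ltW x2y).
Qed.

End bounds_of_J.

(** Squaring [m <= (1 + u) * r] and multiplying by [m <= M * (1 - 4 * u)] gives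
    [m^3 <= (1 - 4 * u) * (1 + u)^2 * (M * r^2)], and
    [(1 - 4 * u) * (1 + u)^2 <= 1]. *)
Lemma relative_bound (R : realFieldType) (m M u r : R) :
  0 < m -> m <= M -> 0 < u -> 4 * u * M <= M - m -> m <= (1 + u) * r ->
  u ^+ 2 * m ^+ 3 / (6 * M) <= (u * r) ^+ 2 / 4.
Proof.
move=> m0 mM u0 uM mr.
have M0 : 0 < M by lra.
have r0 : 0 < r by nra.
have u1 : 4 * u < 1 by nra.
rewrite ler_pdivrMr ?mulr_gt0 //.
have h1 : m ^+ 2 <= (1 + u) ^+ 2 * r ^+ 2.
  by rewrite -exprMn ler_pXn2r // ?nnegrE ?ltW // mulr_gt0 // addr_gt0.
have h2 : m <= M * (1 - 4 * u) by lra.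
have h3 : (1 - 4 * u) * (1 + u) ^+ 2 <= 1 by nra.
have h4 : m ^+ 3 <= M * r ^+ 2.
  apply: (@le_trans _ _ (M * (1 - 4 * u) * ((1 + u) ^+ 2 * r ^+ 2))).
    by rewrite exprS; apply: ler_pM => //; [exact: ltW | exact: sqr_ge0].
  rewrite [leLHS](_ : _ = M * r ^+ 2 * ((1 - 4 * u) * (1 + u) ^+ 2)); last by ring.
  by apply: ler_piMr => //; apply: mulr_ge0; [exact: ltW | exact: sqr_ge0].
have u20 : 0 <= u ^+ 2 by exact: sqr_ge0.
have Mr : 0 <= M * r ^+ 2 by rewrite mulr_ge0 ?ltW ?exprn_gt0.
have := ler_wpM2l u20 h4; have := mulr_ge0 u20 Mr.
rewrite exprMn => *; lra.
Qed.

(** * The squared rounding error cell by cell *)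

(** A Borel measurable lower bound of [(fl y - y)^2], equal to it on the cells and
    to 0 elsewhere. It keeps the integration over J independent of the values of
    [fl] outside the cells. *)
Definition cellwise_sqr (R : realType) (s : seq R) (u y : R) : \bar R :=
  (\sum_(r <- s) ((fun z => ((z - r) ^+ 2)%:E) \_ (cell u r)) y)%E.

Section cellwise_sqr.
Context (R : realType) (s : seq R) (u : R).

Let term_ge0 r y : (0 <= ((fun z => ((z - r) ^+ 2)%:E) \_ (cell u r)) y)%E.
Proof. by rewrite /patch; case: ifP => // _; rewrite lee_fin sqr_ge0. Qed.

Let term_measurable r : measurable_fun [set: measurableTypeR R]
  ((fun z : R => ((z - r) ^+ 2)%:E) \_ (cell u r)).
Proof.
have mC : measurable (cell u r : set (measurableTypeR R)) by rewrite cell_itv.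
apply: (measurable_restrictT _ mC).1; apply: measurable_funTS.
apply/measurable_EFinP.
apply: continuous_measurable_fun => y.
by apply/differentiable_continuous/derivable1_diffP; exact: ex_derive.
Qed.

Lemma cellwise_sqr_ge0 y : (0 <= cellwise_sqr s u y)%E.
Proof. exact: sume_ge0. Qed.

Lemma cellwise_sqr_measurable :
  measurable_fun [set: measurableTypeR R] (cellwise_sqr s u).
Proof. exact: emeasurable_sum. Qed.

(** By the values of [fl] the cells are disjoint, so the sum has at most one
    nonzero term. *)
Lemma cellwise_sqr_le (fl : R -> R) y : uniq s ->
  (forall r, r \in s -> forall z, cell u r z -> fl z = r) ->
  (cellwise_sqr s u y <= ((fl y - y) ^+ 2)%:E)%E.
Proof.
move=> us flE; rewrite /cellwise_sqr.
have [[r rs yr]|no] := pselect (exists2 r, r \in s & cell u r y); last first.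
  rewrite big_seq big1 ?lee_fin ?sqr_ge0 // => r rs.
  by rewrite /patch memNset // => yr; apply: no; exists r.
rewrite (bigD1_seq r) //= big1_seq ?adde0.
  by rewrite /patch mem_set // (flE r rs y yr) -[(y - r) ^+ 2]sqrrN opprB.
move=> r' /andP[r'r r's]; rewrite /patch memNset // => yr'.
by move: r'r; rewrite -(flE r' r's y yr') (flE r rs y yr) eqxx.
Qed.

(** J is covered by the closed cells, which differ from the open ones by null
    sets; so it suffices to bound the mean on each J-part of a cell. *)
Lemma integral_cellwise_sqr_ge (J : set R) (a b c : R) : 0 <= c ->
  J = `]a, b[%classic ->
  J `<=` [set y | exists2 r, r \in s & closure (cell u r) y] ->
  (forall r, r \in s -> J `&` cell u r !=set0 ->
     2 * (u * `|r|) < b - a /\ c <= (u * `|r|) ^+ 2 / 4) ->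
  (c%:E * lebesgue_measure J <=
    \int[lebesgue_measure]_(y in J) cellwise_sqr s u y)%E.
Proof.
move=> c0 JE Js Hr.
have mJ : measurable (J : set (measurableTypeR R)) by rewrite JE.
rewrite ge0_integral_sum //; last first.
  by move=> r; apply: measurable_funTS; exact: term_measurable.
have : J `<=` [set y | exists2 r, r \in s &
    (`[r - u * `|r|, r + u * `|r|]%classic : set R) y].
  by move=> y /Js[r rs /closure_cell_sub ry]; exists r.
move=> /outer_measure_seq_cover cov.
apply: (@le_trans _ _ (c%:E * \sum_(r <- s) lebesgue_measure (J `&` cell u r))%E).
  apply: lee_wpmul2l => //; apply: (le_trans cov); apply: lee_sum => r _.
  by rewrite cell_itv; exact: measure_itvcc_sub.
rewrite ge0_sume_distrr; last by move=> r _; exact: outer_measure_ge0.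
rewrite !big_seq; apply: lee_sum => r rs; rewrite -integral_mkcondr.
have [/(Hr r rs)[lt le]|/set0P/negP/negPn/eqP ->] :=
    pselect (J `&` cell u r !=set0); last first.
  by rewrite measure0 mule0 integral_set0.
rewrite cell_itv JE.
apply: le_trans (integral_sqr_cell_ge r lt).
by apply: lee_wpmul2r; [exact: outer_measure_ge0 | rewrite lee_fin].
Qed.

End cellwise_sqr.

(** * The smallest cardinal of a fibre *)

Lemma counting_ge_seq (T : choiceType) (R : realType) (S : set T) (n : nat) :
  (n%:R%:E <= counting S :> \bar R)%E ->
  exists s : seq T, [/\ uniq s, size s = n & forall x, x \in s -> S x].
Proof.
move=> nS; suff [B BS nB] : exists2 B : {fset T}, [set` B] `<=` S & (n <= #|` B|)%N.
  exists (take n B); split.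
  - exact/take_uniq/fset_uniq.
  - exact: size_takel.
  - by move=> x /mem_take /BS.
have [fS|iS] := pselect (finite_set S); last exact: infinite_set_fset.
exists (fset_set S); first by rewrite fset_setK.
by move: nS; rewrite /counting asboolT // lee_fin ler_nat.
Qed.

Lemma counting_nat (T : choiceType) (R : realType) (S : set T) :
  counting S = +oo%E :> \bar R \/ exists k : nat, counting S = k%:R%:E :> \bar R.
Proof.
by rewrite /counting; case: asboolP; [right; exists (#|` fset_set S |) | left].
Qed.

Lemma counting_ge1 (T : choiceType) (R : realType) (S : set T) :
  S !=set0 -> (1 <= counting S :> \bar R)%E.
Proof.
move=> /set0P S0; have [->|[k kE]] := counting_nat R S; first exact: leey.
rewrite kE lee_fin ler1n lt0n; apply: contra_neq S0 => k0.
move: kE; rewrite k0 /counting; case: asboolP => // fS /eqP.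
rewrite eqe pnatr_eq0 cardfs_eq0 => /eqP S0.
by rewrite -(fset_setK fS) S0 set_fset0.
Qed.

Section min_card.
Context (R : realType) (X J : set R) (phi : R -> R).
Hypothesis Jphi : J `<=` phi @` X.

Lemma min_card_ge1 : (1 <= min_card X phi J)%E.
Proof.
apply: le_ereal_inf_tmp => _ [y /Jphi[x Xx xy] <-].
by apply: counting_ge1; exists x.
Qed.

(** The infimum of the cardinals of the fibres is attained: if it is a real v and
    n is the least natural number with [v <= n%:R], then every cardinal, being a
    natural number or infinite, is at least n. *)
Lemma min_card_nat : min_card X phi J = +oo%E \/
  exists n : nat, min_card X phi J = n%:R%:E.
Proof.
have := min_card_ge1; case E : (min_card X phi J) => [v| |] // _; last by left.
right; have ex : exists n : nat, v <= n%:R.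
  by exists (Num.truncn v).+1; rewrite ltW // truncnS_gt.
case: (ex_minnP ex) => n vn minn; exists n.
apply/eqP; rewrite eq_le lee_fin vn /= -E.
apply: le_ereal_inf_tmp => _ [y Jy <-].
have : (min_card X phi J <= counting (preimage_in X phi [set y]))%E.
  by apply: ereal_inf_lbound; exists y.
rewrite E.
have [->|[k ->]] := counting_nat R (preimage_in X phi [set y]).
  by move=> _; rewrite leey.
by rewrite !lee_fin ler_nat => /minn.
Qed.

Lemma fibre_seq n : (n%:R%:E <= min_card X phi J)%E ->
  forall y, J y -> exists s : seq R,
    [/\ uniq s, size s = n & forall x, x \in s -> X x /\ phi x = y].
Proof.
move=> nJ y Jy.
have [|s [us sn sX]] := @counting_ge_seq _ R (preimage_in X phi [set y]) n.
  by apply: (le_trans nJ); apply: ereal_inf_lbound; exists y.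
by exists s; split => // x /sX[].
Qed.

End min_card.

(** * The error bound *)

Section main.
Context (R : realType) (X J : set R) (phi dphi : R -> R).
Hypothesis mX : lebesgue_measurable_set X.
Hypothesis phiC1 : is_C1_on X phi dphi.
Hypothesis openJ : open J.
Hypothesis connectedJ : connected J.
Hypothesis Jphi : J `<=` phi @` X.
Hypothesis m_gt0 : 0 < min_abs J.
Hypothesis L_fin : has_ubound (slopes X phi dphi J).

Let L := sup (slopes X phi dphi J).
Let c0 := interval_length J / (6 * L) * (min_abs J ^+ 3 / max_abs J).

Let J0 : J !=set0. Proof. exact: min_abs_gt0_nonempty. Qed.

Let dphiL x : preimage_in X phi J x -> `|dphi x| <= L.
Proof. by move=> Ax; apply: ub_le_sup => //; exists x. Qed.

Let L0 : 0 < L. Proof. exact: (slope_bound_gt0 phiC1 dphiL). Qed.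

Section rounding.
Context (fl : R -> R) (F : set R) (u : R).
Hypothesis rfl : is_rounding fl F u.
Hypothesis JF : J `<=` \bigcup_(r in F) closure (cell u r).
Hypothesis uJ : 4 * u * max_abs J <= interval_length J.

Let bndJ : has_ubound [set `|y| | y in J].
Proof.
have [_ /finite_seqP[s Fs] _ _] := rfl.
exists (\sum_(r <- s) (`|r| + u * `|r|)) => _ [y Jy <-].
have [r Fr /closure_cell_sub] := JF Jy; rewrite /= in_itv /= -ler_distl => yr.
have u0 : 0 < u by case: rfl.
have rs : r \in s by move: Fr; rewrite Fs.
apply: (@le_trans _ _ (`|r| + u * `|r|)).
  have := ler_normD r (y - r); rewrite addrC subrK => le; lra.
rewrite (big_rem r) //= lerDl; apply: sumr_ge0 => r' _.
by rewrite addr_ge0 // mulr_ge0 // ltW.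
Qed.

Let u_gt0 : 0 < u. Proof. by case: rfl. Qed.

Let J_itv : J = `]inf J, sup J[%classic.
Proof. by apply: open_interval_itv => //; apply/connected_intervalP. Qed.

Let m_le_M : min_abs J <= max_abs J.
Proof.
by have [y Jy] := J0; apply: (le_trans (min_abs_le Jy)); exact: le_max_abs.
Qed.

Let len_gt0 : 0 < interval_length J.
Proof.
by apply: lt_le_trans uJ; rewrite !mulr_gt0 // (lt_le_trans m_gt0).
Qed.

Lemma constant_factor_gt0 : 0 < c0.
Proof.
by rewrite mulr_gt0 // divr_gt0 ?mulr_gt0 ?exprn_gt0 // (lt_le_trans m_gt0).
Qed.

(** The bound with n in place of the smallest cardinal of a fibre: on the
    target side [integral_cellwise_sqr_ge], with [relative_bound] on each cell,
    then [natmul_integral_le_preimage]. *)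
Lemma error_ge_natmul (n : nat) : (n%:R%:E <= min_card X phi J)%E ->
  ((c0 * n%:R * u ^+ 2)%:E <=
     L2norm (preimage_in X phi J) (fun x => fl (phi x) - phi x)%R ^+ 2)%E.
Proof.
move=> nJ.
have lenM : interval_length J <= max_abs J - min_abs J.
  by apply: interval_length_le_abs => //; apply/connected_intervalP.
have [_ /finite_seqP[s0 Fs0] _ flE] := rfl.
pose s := undup s0.
have sF r : r \in s -> F r by rewrite mem_undup Fs0.
pose c := u ^+ 2 * min_abs J ^+ 3 / (6 * max_abs J).
have cge0 : 0 <= c.
  by rewrite divr_ge0 ?mulr_ge0 ?sqr_ge0 ?exprn_ge0 ?(le_trans _ m_le_M) // ltW.
have intJ : (c%:E * lebesgue_measure J <=
    \int[lebesgue_measure]_(y in J) cellwise_sqr s u y)%E.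
  apply: integral_cellwise_sqr_ge cge0 J_itv _ _.
    move=> y /JF[r]; rewrite Fs0 => rs ry; exists r => //.
    by rewrite mem_undup.
  move=> r _ [y [Jy]]; rewrite /cell /= => yr.
  have my := min_abs_le Jy; have yM := le_max_abs bndJ Jy.
  have ry : `|r| <= `|y| + `|y - r|.
    by have := ler_normB y (y - r); rewrite opprB addrC subrK.
  have yr' : `|y| <= `|r| + `|y - r|.
    by have := ler_normD r (y - r); rewrite addrC subrK.
  have r0 : 0 <= `|r| by [].
  have uM : 4 * u * max_abs J <= max_abs J - min_abs J := le_trans uJ lenM.
  have mM := m_le_M; have m0 := m_gt0; have u0 := u_gt0.
  split; last by apply: (relative_bound m0 mM u0 uM); lra.
  apply: lt_le_trans uJ.
  have ur : 0 <= u * `|r| by rewrite mulr_ge0 // ltW.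
  have h1 : (1 - u) * `|r| <= max_abs J by lra.
  have h2 : 4 * u < 1 by nra.
  (* The cell is thus shorter than [4 * u * M]. *)
  have h3 : `|r| < 2 * max_abs J by nra.
  nra.
have := natmul_integral_le_preimage (n := n) mX phiC1 dphiL L0 _
  (min_abs_gt0_notin0 m_gt0) (fibre_seq nJ) (cellwise_sqr_measurable s u)
  (cellwise_sqr_ge0 s u).
move=> /(_ (open_measurable openJ)) H.
rewrite L2normE.
set I := (\int[_]_(x in _) _)%E.
suff : ((c * interval_length J * n%:R)%:E <= L%:E * I)%E.
  have -> : c * interval_length J * n%:R = L * (c0 * n%:R * u ^+ 2).
    by rewrite /c /c0; field; rewrite !gt_eqF // (lt_le_trans m_gt0).
  by rewrite EFinM lee_pmul2l // lte_fin.
apply: (@le_trans _ _ (n%:R%:E * (c%:E * lebesgue_measure J))%E).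
  rewrite {2}J_itv lebesgue_measure_itv /= lte_fin -subr_gt0 len_gt0.
  by rewrite -EFinB -!EFinM lee_fin mulrC.
apply: le_trans (lee_wpmul2l _ intJ) _; first by rewrite lee_fin.
apply: (le_trans H); apply: lee_wpmul2l; first by rewrite lee_fin ltW.
apply: ge0_le_integral_restrict => [x _|x _|x].
- exact: cellwise_sqr_ge0.
- by rewrite lee_fin sqr_ge0.
- rewrite /patch; case: ifP => // _; apply: cellwise_sqr_le.
    exact: undup_uniq.
  by move=> r /sF; exact: flE.
Qed.

(** If the fibres are all infinite, [error_ge_natmul] holds for every n and the
    norm is infinite. *)
Lemma rounding_explicit_bound :
  (0 < explicit_constant X phi dphi J)%E /\
  roundoff_bound X phi J fl u (explicit_constant X phi dphi J).
Proof.
have c00 := constant_factor_gt0.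
have K1 := min_card_ge1 Jphi.
rewrite /explicit_constant -/L -/c0; split.
  by apply: mule_gt0; rewrite ?lte_fin // (lt_le_trans _ K1).
split; first by apply: L2norm_sub => x [].
have [Koo|[n Kn]] := min_card_nat Jphi.
  rewrite Koo gt0_muley ?lte_fin // gt0_mulye ?lte_fin ?exprn_gt0 //.
  rewrite leye_eq; apply/eqP/eqyP => A A0.
  have v0 : 0 < c0 * u ^+ 2 by rewrite mulr_gt0 ?exprn_gt0.
  have nJ : ((Num.truncn (A / (c0 * u ^+ 2))).+1%:R%:E <= min_card X phi J)%E.
    by rewrite Koo leey.
  apply: le_trans (error_ge_natmul nJ).
  by rewrite lee_fin mulrAC mulrC -ler_pdivrMr // ltW // truncnS_gt.
rewrite Kn -!EFinM; apply: error_ge_natmul.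
by rewrite Kn.
Qed.

End rounding.

Lemma roundoff_bound_le fl u (C C' : \bar R) : (C <= C')%E ->
  roundoff_bound X phi J fl u C' -> roundoff_bound X phi J fl u C.
Proof.
move=> CC' [le1 le2]; split=> //; apply: le_trans le2.
by apply: lee_wpmul2r => //; rewrite lee_fin sqr_ge0.
Qed.

(** The constant [c0], which corresponds to fibres with one point, does not
    involve [u]. It is positive as soon as one rounding satisfies the hypotheses;
    otherwise, for instance if J is unbounded, any constant does. *)
Lemma rounding_uniform_bound : exists C : R, 0 < C /\
  forall (fl : R -> R) (F : set R) (u : R),
    is_rounding fl F u ->
    J `<=` \bigcup_(r in F) closure (cell u r) ->
    4 * u * max_abs J <= interval_length J ->
    roundoff_bound X phi J fl u C%:E.
Proof.
have [c00|c0N] := ltP 0 c0; last first.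
  exists 1; split=> // fl F u rfl JF uJ.
  by have := constant_factor_gt0 rfl JF uJ; rewrite ltNge c0N.
exists c0; split=> // fl F u rfl JF uJ.
have [_] := rounding_explicit_bound rfl JF uJ.
apply: roundoff_bound_le; rewrite /explicit_constant -/L -/c0.
by apply: lee_pemulr; [rewrite lee_fin ltW | exact: min_card_ge1].
Qed.

End main.

Unset Implicit Arguments.

Theorem theorem6 (R : realType) (X J : set R) (phi dphi : R -> R)
  (mX : lebesgue_measurable_set X)
  (phiC1 : is_C1_on X phi dphi)
  (openJ : open J) (connectedJ : connected J)
  (Jphi : J `<=` phi @` X)
  (m_gt0 : 0 < min_abs J)
  (L_fin : has_ubound (slopes X phi dphi J)) :
  (exists C : R, 0 < C /\
    forall (fl : R -> R) (F : set R) (u : R),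
      is_rounding fl F u ->
      J `<=` \bigcup_(r in F) closure (cell u r) ->
      4 * u * max_abs J <= interval_length J ->
      roundoff_bound X phi J fl u C%:E) /\
  (forall (fl : R -> R) (F : set R) (u : R),
      is_rounding fl F u ->
      J `<=` \bigcup_(r in F) closure (cell u r) ->
      4 * u * max_abs J <= interval_length J ->
      (0 < explicit_constant X phi dphi J)%E /\
      roundoff_bound X phi J fl u (explicit_constant X phi dphi J)).
Proof.
split.
  exact: (rounding_uniform_bound mX phiC1 openJ connectedJ Jphi m_gt0 L_fin).
by move=> fl F u rfl JF uJ; exact: rounding_explicit_bound rfl JF uJ.
Qed.
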